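(* Let $M:(0,\infty)\times(0,\infty)\to(0,\infty)$ be a mean and let $r$ be a real function defined on $(0,\infty)$ with $\lim_{x\to\infty}r(x)=0$. Then for fixed real numbers $\theta,\sigma$ (and $x>-\min(1,\theta,\sigma)$), we have $$\Gamma(x+1)\sim\sqrt{2\pi}\,M(x+\theta,x+\sigma)^{x+1/2}\,e^{-M(x+\theta,x+\sigma)}\,e^{r(x)}\quad\text{as }x\to\infty.$$
   Context: $\Gamma$ is Euler's gamma function. For an interval $I\subseteq\mathbb{R}$, a function $M:I^2\to\mathbb{R}$ is a (bivariate) mean if $\min(a,b)\le M(a,b)\le\max(a,b)$ for all $a,b\in I$. The notation $f(x)\sim g(x)$ as $x\to\infty$ means $\lim_{x\to\infty}f(x)/g(x)=1$. *)

(* Defs.v *)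
From HB Require Import structures.
From mathcomp Require Import all_boot all_order all_algebra.
From mathcomp Require Import all_classical all_reals all_analysis.

Set Implicit Arguments.
Unset Strict Implicit.
Unset Printing Implicit Defensive.

Import Order.TTheory GRing.Theory Num.Theory.
Import numFieldNormedType.Exports.

Local Open Scope classical_set_scope.
Local Open Scope ring_scope.

(* Euler's integral for the gamma function. For x > 0 the integral converges;
   for x <= 0 it diverges and Gamma x takes the junk value fine +oo = 0, so
   this is the gamma function on (0, +oo) only. *)
Definition Gamma (R : realType) (x : R) : R :=
  \int[@lebesgue_measure R]_(t in `]0, +oo[) (t `^ (x - 1) * expR (- t)).

(* M is a total function, but only its values on I x I are constrained. *)
Definition is_mean (R : realType) (I : interval R) (M : R -> R -> R) : Prop :=
  forall a b : R, a \in I -> b \in I ->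
    Num.min a b <= M a b <= Num.max a b.

(* Division by 0 yields 0, so the limit 1 forces g to be eventually nonzero. *)
Definition asymp_equiv (R : realType) (f g : R -> R) : Prop :=
  f x / g x @[x --> +oo] --> (1 : R).

(* Main.v *)
(* Laplace's method. Substituting t = x + sqrt(x) u in Euler's integral gives
   Gamma(x+1) = x^(x+1/2) e^(-x) K(x), where K(x) is the integral over u of
   exp(-x h(u/sqrt x)), h(v) = v - ln(1+v), over u > -sqrt x. The integrand
   tends to exp(-u^2/2) and is dominated by exp(1-|u|/2) once x >= 1, so
   K(x) -> sqrt(2 pi). The mean then only contributes a bounded shift:
   M(x+theta, x+sigma) = x + t(x) with |t(x)| <= |theta| + |sigma|, and
   (x+1/2) ln(1+t/x) - t -> 0 uniformly for bounded t. *)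

Require Import Defs.
From HB Require Import structures.
From mathcomp Require Import all_boot all_order all_algebra.
From mathcomp Require Import all_classical all_reals all_analysis.
From mathcomp Require Import measurable_realfun.
From mathcomp Require Import ring lra.

Import Order.TTheory GRing.Theory Num.Theory.
Import numFieldNormedType.Exports.

Local Open Scope classical_set_scope.
Local Open Scope ring_scope.

(** * Estimates for [v - ln (1 + v)] *)

Lemma le_subr_ln1D (R : realType) (v : R) : -1 < v ->
  v ^+ 2 / (2 * (2 + v)) <= v - ln (1 + v).
Proof.
(* Apply ln s <= s - 1 to s = sqrt (1 + v). *)
move=> v1; have v0 : 0 < 1 + v by lra.
set s := Num.sqrt (1 + v).
have s0 : 0 < s by rewrite sqrtr_gt0.
have s2 : s ^+ 2 = 1 + v by rewrite sqr_sqrtr// ltW.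
have -> : ln (1 + v) = ln s * 2.
  by rewrite -s2 lnXn// mulr_natr.
have : ln (1 + (s - 1)) <= s - 1 by apply: le_ln1Dx; lra.
rewrite (addrC 1) subrK => lns.
have -> : v = s ^+ 2 - 1 by lra.
apply: (@le_trans _ _ ((s - 1) ^+ 2)); last by nra.
rewrite ler_pdivrMr; last nra.
have -> : (s ^+ 2 - 1) ^+ 2 = (s - 1) ^+ 2 * (s + 1) ^+ 2 by ring.
by rewrite ler_wpM2l ?sqr_ge0//; have := sqr_ge0 (s - 1); lra.
Qed.

(** Mean value theorem between 1 and [1 + v] for [p] below, whose derivative is
    [- (y - 1) ^+ 2 / y]. There [y >= 1 / 2], so the derivative is at most [2 * v ^+ 2] in absolute
    value. *)
Lemma subr_ln1D_approx (R : realType) (v : R) : `|v| <= 1 / 2 ->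
  `|v - ln (1 + v) - v ^+ 2 / 2| <= 2 * `|v| ^+ 3.
Proof.
move=> v2.
pose p (y : R) := y - ln y - 2^-1 * (y - 1) ^+ 2.
have dp (y : R) : 0 < y -> is_derive y 1 p (- (y - 1) ^+ 2 / y).
  move=> y0; rewrite /p; have := is_derive1_ln y0 => dln.
  apply: is_derive_eq; rewrite /GRing.scale/=.
  by field; lra.
have p1 : p 1 = 1 by rewrite /p ln1 subrr; lra.
have cp (a b : R) : 0 < a -> {within `[a, b], continuous p}.
  move=> a0; apply: derivable_within_continuous => y.
  rewrite in_itv/= => /andP[ay _].
  have y0 : 0 < y by lra.
  by have [] := dp _ y0.
have bound (c : R) : `|c - 1| <= `|v| -> `|- (c - 1) ^+ 2 / c| <= 2 * `|v| ^+ 2.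
  move=> cv; have c2 : 1 / 2 <= c.
    by have := le_trans cv v2; rewrite ler_norml => /andP[]; lra.
  rewrite normrM normrN normrX normfV (gtr0_norm (_ : 0 < c)); last lra.
  rewrite ler_pdivrMr; last lra.
  have := normr_ge0 (c - 1); nra.
have -> : v - ln (1 + v) - v ^+ 2 / 2 = p (1 + v) - p 1.
  rewrite p1 /p; lra.
have cubeE : 2 * `|v| ^+ 3 = 2 * `|v| ^+ 2 * `|v| by ring.
move: (v2); rewrite ler_norml => /andP[v2l v2r].
have [v0|v0] := leP 0 v.
  have [|||c] := @MVT_segment R p (fun y => - (y - 1) ^+ 2 / y) 1 (1 + v).
  - lra.
  - by move=> y; rewrite in_itv/= => /andP[y1 _]; apply: dp; lra.
  - by apply: cp.
  rewrite in_itv/= => /andP[c1 cv] ->.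
  rewrite (addrC 1) addrK normrM cubeE ler_wpM2r// bound//.
  by rewrite !ger0_norm; lra.
have [|||c] := @MVT_segment R p (fun y => - (y - 1) ^+ 2 / y) (1 + v) 1.
- lra.
- by move=> y; rewrite in_itv/= => /andP[y1 _]; apply: dp; lra.
- by apply: cp; lra.
rewrite in_itv/= => /andP[c1 cv].
rewrite -(opprB (p 1)) => ->.
rewrite opprD addrA subrr add0r normrN normrM normrN cubeE ler_wpM2r// bound//.
by rewrite !ler0_norm; lra.
Qed.

(** * The rescaled integrand: continuity, domination, pointwise limit *)

(** Truncating the base at 0 lets measurability and the substitution be handled on the whole line.
    The delicate point is [y = 0], where both one-sided limits are 0 because [x > 0]. *)
Lemma continuous_max0_powR (R : realType) (x : R) : 0 < x ->
  continuous (fun y : R => (Num.max 0 y) `^ x).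
Proof.
move=> x0 y; have [y0|y0|->] := ltgtP y 0.
- apply: cvg_near_cst.
  near=> z; rewrite !max_l ?(ltW y0)//.
  by apply: ltW; near: z; exact: lt_nbhsl.
- have cy : {for y, continuous (fun z : R => z `^ x)}.
    apply: differentiable_continuous; apply/derivable1_diffP.
    by apply: derivable_powR; rewrite in_itv/= y0.
  rewrite /continuous_at max_r ?(ltW y0)//.
  apply: cvg_trans cy; apply: near_eq_cvg; near=> z.
  rewrite max_r//; apply: ltW; near: z; exact: lt_nbhsr.
- apply/left_right_continuousP; rewrite maxxx powR0 ?gt_eqF//; split.
    apply: cvg_near_cst; near=> z.
    by rewrite max_l ?powR0 ?gt_eqF//; near: z; exact: nbhs_left_le.
  apply: cvg_trans (powR_cvg0 x0); apply: near_eq_cvg; near=> z.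
  by rewrite max_r//; near: z; exact: nbhs_right_ge.
Unshelve. all: by end_near. Qed.

(* t^x e^(-t) at t = x + sqrt(x) u, divided by x^x e^(-x); the max extends it
   continuously by 0 to u <= -sqrt x. *)
Definition gamma_kernel {R : realType} (x u : R) : R :=
  (Num.max 0 (1 + u / Num.sqrt x)) `^ x * expR (- (Num.sqrt x * u)).

Lemma gamma_kernel_ge0 (R : realType) (x u : R) : 0 <= gamma_kernel x u.
Proof. by rewrite mulr_ge0 ?powR_ge0 ?expR_ge0. Qed.

Lemma continuous_gamma_kernel (R : realType) (x : R) : 0 < x ->
  continuous (gamma_kernel x).
Proof.
move=> x0 u; rewrite /gamma_kernel; apply: cvgM.
  apply: (@continuous_comp _ _ _ (fun u : R => 1 + u / Num.sqrt x)
    (fun y : R => (Num.max 0 y) `^ x)); last exact: continuous_max0_powR.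
  by apply: cvgD; [exact: cvg_cst|apply: cvgM; [exact: cvg_id|exact: cvg_cst]].
apply: (@continuous_comp _ _ _ (fun u : R => - (Num.sqrt x * u)) expR).
  by apply: cvgN; apply: cvgM; [exact: cvg_cst|exact: cvg_id].
exact: continuous_expR.
Qed.

Lemma gamma_kernel_exp (R : realType) (x u : R) : 0 < x -> - Num.sqrt x < u ->
  gamma_kernel x u =
  expR (- (x * (u / Num.sqrt x - ln (1 + u / Num.sqrt x)))).
Proof.
move=> x0 xu; rewrite /gamma_kernel.
have s0 : 0 < Num.sqrt x by rewrite sqrtr_gt0.
have v0 : 0 < 1 + u / Num.sqrt x.
  by rewrite -(ltrD2l (-1)) addKr addr0 ltr_pdivlMr// mulN1r.
rewrite max_r ?(ltW v0)// /powR gt_eqF// -expRD; congr expR.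
rewrite mulrBr opprB; congr (_ - _).
by rewrite -{2}(sqr_sqrtr (ltW x0)); field; rewrite gt_eqF.
Qed.

(** With v = u / sqrt x, the lower bound on v - ln (1 + v) makes the negated exponent at least u^2 /
    (2 (2 + v)). Since sqrt x >= 1 gives v <= |u|, this is at least |u|/2 - 1, because (|u| - 2)(|u|
    + 2) <= u^2. The bound is free of x, as dominated convergence requires. *)
Lemma gamma_kernel_le (R : realType) (x u : R) : 1 <= x ->
  gamma_kernel x u <= expR (1 - `|u| / 2).
Proof.
move=> x1; have x0 : 0 < x by lra.
have s1 : 1 <= Num.sqrt x by rewrite -(sqrtr1 R) ler_wsqrtr.
have s2 : Num.sqrt x ^+ 2 = x by rewrite sqr_sqrtr// ltW.
have s0 : 0 < Num.sqrt x by lra.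
have [ux|xu] := leP u (- Num.sqrt x).
  rewrite /gamma_kernel max_l ?powR0 ?gt_eqF// ?mul0r ?expR_ge0//.
  by rewrite -(lerD2l (-1)) addKr addr0 ler_pdivrMr// mulN1r.
rewrite gamma_kernel_exp// ler_expR -[leRHS]opprB lerN2.
set v := u / Num.sqrt x.
have uE : u = Num.sqrt x * v by rewrite /v; field; rewrite gt_eqF.
have v1 : -1 < v by rewrite ltr_pdivlMr// mulN1r.
apply: le_trans _ (ler_wpM2l (ltW x0) (le_subr_ln1D _ _ v1)).
rewrite mulrA ler_pdivlMr; last lra.
have -> : x * v ^+ 2 = `|u| ^+ 2.
  by rewrite real_normK ?num_real// {1}uE -[in LHS]s2 -exprMn.
have vu : v <= `|u|.
  have := ler_norm u; rewrite {1}uE; have := normr_ge0 u; nra.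
have := normr_ge0 u; nra.
Qed.

Lemma gamma_kernel_cvg (R : realType) (u : R) :
  gamma_kernel x u @[x --> +oo] --> expR (- (u ^+ 2 / 2)).
Proof.
have cvgE : x * (u / Num.sqrt x - ln (1 + u / Num.sqrt x)) @[x --> +oo]
    --> u ^+ 2 / 2.
  apply/cvgrPdist_le => e e0; near=> x.
  have x0 : 0 < x by near: x; apply: nbhs_pinfty_gt; exact: num_real.
  have s0 : 0 < Num.sqrt x by rewrite sqrtr_gt0.
  have s2 : Num.sqrt x ^+ 2 = x by rewrite sqr_sqrtr// ltW.
  have sA (A : R) : 0 <= A -> A ^+ 2 <= x -> A <= Num.sqrt x.
    by move=> A0 Ax; rewrite -(ger0_norm A0) -sqrtr_sqr ler_wsqrtr.
  (* [su] gives |v| <= 1/2, so the cubic estimate applies; [se] then makes its error x * 2|v|^3 =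
     2|u|^3 / sqrt x at most [e]. *)
  have su : 2 * `|u| <= Num.sqrt x.
    apply: sA; first by rewrite mulr_ge0.
    by near: x; apply: nbhs_pinfty_ge; exact: num_real.
  have se : 2 * `|u| ^+ 3 / e <= Num.sqrt x.
    apply: sA; [by rewrite divr_ge0 ?mulr_ge0 ?exprn_ge0// ltW|].
    by near: x; apply: nbhs_pinfty_ge; exact: num_real.
  set v := u / Num.sqrt x.
  have uE : u = Num.sqrt x * v by rewrite /v; field; rewrite gt_eqF.
  have nuE : `|u| = Num.sqrt x * `|v| by rewrite {1}uE normrM gtr0_norm.
  rewrite distrC.
  have -> : x * (v - ln (1 + v)) - u ^+ 2 / 2 =
      x * (v - ln (1 + v) - v ^+ 2 / 2).
    by rewrite {1}uE exprMn s2; lra.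
  rewrite normrM gtr0_norm//.
  have v2 : `|v| <= 1 / 2 by rewrite nuE in su; nra.
  apply: le_trans (ler_wpM2l (ltW x0) (subr_ln1D_approx _ _ v2)) _.
  rewrite -(ler_pM2r s0).
  move: se; rewrite ler_pdivrMr// nuE => se.
  apply: le_trans (_ : 2 * (Num.sqrt x * `|v|) ^+ 3 <= _);
    last by rewrite (mulrC e).
  by rewrite -{1}s2 le_eqVlt; apply/orP; left; apply/eqP; ring.
apply: (@cvg_trans _ (expR (- (x * (u / Num.sqrt x - ln (1 + u / Num.sqrt x))))
    @[x --> +oo])).
  apply: near_eq_cvg; near=> x.
  have x0 : 0 < x by near: x; apply: nbhs_pinfty_gt; exact: num_real.
  rewrite gamma_kernel_exp// ltrNl.
  apply: le_lt_trans (_ : `|u| < _); first by rewrite -normrN ler_norm.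
  have ux : `|u| ^+ 2 < x by near: x; apply: nbhs_pinfty_gt; exact: num_real.
  by rewrite -(ger0_norm (normr_ge0 u)) -sqrtr_sqr ltr_sqrt.
by apply: continuous_cvg; [exact: continuous_expR|exact: cvgN].
Unshelve. all: by end_near. Qed.

(** * Integrals over the line and their limit *)

(** By symmetry the integral is twice that over the half-line, where the function is [2 * expR 1]
    times the exponential density of rate 1/2, of total mass 1. *)
Lemma integrable_expR_abs (R : realType) :
  (@lebesgue_measure R).-integrable [set: R]
    (fun u => (expR (1 - `|u| / 2))%:E).
Proof.
have cg : continuous (fun u : R => expR (1 - `|u| / 2)).
  move=> u; apply: (@continuous_comp _ _ _ (fun u : R => 1 - `|u| / 2) expR).
    apply: cvgB; first exact: cvg_cst.
    by apply: cvgM; [exact: norm_continuous|exact: cvg_cst].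
  exact: continuous_expR.
apply/integrableP; split.
  by apply/measurable_EFinP; exact: continuous_measurable_fun.
under eq_integral do rewrite /= ger0_norm ?expR_ge0//.
rewrite ge0_symfun_integralT//; last by move=> u /=; rewrite normrN.
apply: lte_mul_pinfty => //.
pose c : R := 2 * expR 1.
have gE (u : R) : 0 <= u ->
    expR (1 - `|u| / 2) = c * exponential_pdf (2^-1) u.
  move=> u0; rewrite exponential_pdfE//= ger0_norm// expRD /c.
  have -> : - (u / 2) = - 2^-1 * u by lra.
  by field.
apply: (@le_lt_trans _ _
    (\int[lebesgue_measure]_u (c%:E * (exponential_pdf (2^-1) u)%:E)))%E.
  under eq_integral => u.
    rewrite inE /= => u0; rewrite gE// EFinM; over.
  apply: ge0_subset_integral => //.
  - by rewrite -set_itvcy.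
  - apply: measurable_funeM; apply/measurable_EFinP.
    exact: measurable_exponential_pdf.
  - move=> u _; rewrite -EFinM lee_fin mulr_ge0// ?exponential_pdf_ge0//.
    by rewrite mulr_ge0 ?expR_ge0.
rewrite ge0_integralZl//.
- by rewrite integral_exponential_pdf// mule1 ltry.
- by apply/measurable_EFinP; exact: measurable_exponential_pdf.
- by move=> u _; rewrite lee_fin exponential_pdf_ge0.
- by rewrite lee_fin mulr_ge0 ?expR_ge0.
Qed.

Lemma integrable_gamma_kernel (R : realType) (x : R) : 1 <= x ->
  (@lebesgue_measure R).-integrable [set: R] (EFin \o gamma_kernel x).
Proof.
move=> x1; have x0 : 0 < x by lra.
apply: le_integrable (integrable_expR_abs R) => //.
  apply/measurable_EFinP; apply: continuous_measurable_fun.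
  exact: continuous_gamma_kernel.
move=> u _ /=; rewrite lee_fin (ger0_norm (gamma_kernel_ge0 _ _ _))
  (ger0_norm (expR_ge0 _)).
exact: gamma_kernel_le.
Qed.

(** The integrand is the standard normal density freed of its normalising factor. *)
Lemma integral_expR_sqr2 (R : realType) :
  (\int[@lebesgue_measure R]_u (expR (- (u ^+ 2 / 2)))%:E =
   (Num.sqrt (2 * pi))%:E)%E.
Proof.
have s0 : 0 < Num.sqrt (2 * pi : R) by rewrite sqrtr_gt0 mulr_gt0 ?pi_gt0.
have pE (u : R) : expR (- (u ^+ 2 / 2)) = Num.sqrt (2 * pi) * normal_pdf 0 1 u.
  rewrite normal_pdfE ?oner_neq0// /normal_peak /normal_fun.
  rewrite expr1n mul1r subr0 (mulr_natl pi 2) mulrA divff; last first.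
    by rewrite -mulr_natl gt_eqF.
  by rewrite mul1r mulNr.
under eq_integral do rewrite pE EFinM.
rewrite integralZl//; last exact: integrable_normal_pdf.
by rewrite integral_normal_pdf mule1.
Qed.

Lemma gamma_kernel_integral_cvg (R : realType) :
  \int[@lebesgue_measure R]_u gamma_kernel x u @[x --> +oo] -->
  (Num.sqrt (2 * pi) : R).
Proof.
(* Replacing [x] by [Num.max 1 x] changes nothing near +oo, but makes the domination hold at every
   term of a sequence, not just eventually. *)
suff : \int[@lebesgue_measure R]_u gamma_kernel (Num.max 1 x) u @[x --> +oo] -->
    (Num.sqrt (2 * pi) : R).
  apply: cvg_trans; apply: near_eq_cvg; near=> x.
  by rewrite max_r//; near: x; apply: nbhs_pinfty_ge; exact: num_real.
(* Dominated convergence concerns sequences, so the limit is tested along an arbitrary sequence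
   tending to +oo. *)
apply/cvg_pinftyP => x_ xoo.
have x_1 n : 1 <= Num.max 1 (x_ n) by rewrite le_max lexx.
have x_0 n : 0 < Num.max 1 (x_ n) by apply: lt_le_trans (x_1 n).
have mk n : measurable_fun [set: R] (gamma_kernel (Num.max 1 (x_ n))).
  by apply: continuous_measurable_fun; exact: continuous_gamma_kernel.
have [|||||_ _] := @dominated_convergence _ _ R (@lebesgue_measure R) setT
  measurableT (fun n u => (gamma_kernel (Num.max 1 (x_ n)) u)%:E)
  (fun u => (expR (- (u ^+ 2 / 2)))%:E) (fun u => (expR (1 - `|u| / 2))%:E).
- by move=> n; apply/measurable_EFinP; exact: mk.
- apply/measurable_EFinP; apply: continuous_measurable_fun => u.
  apply: (@continuous_comp _ _ _ (fun u : R => - (u ^+ 2 / 2)) expR).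
    by apply: cvgN; apply: cvgM; [exact: exprn_continuous|exact: cvg_cst].
  exact: continuous_expR.
- apply: aeW => u _; apply: cvg_EFin; first exact: nearW.
  have /cvg_pinftyP := gamma_kernel_cvg R u; apply.
  apply/cvgryPge => A; near=> n.
  by rewrite le_max; apply/orP; right; near: n; move/cvgryPge: xoo; exact.
- exact: integrable_expR_abs.
- apply: aeW => u n _ /=; rewrite lee_fin ger0_norm ?gamma_kernel_ge0//.
  exact: gamma_kernel_le.
rewrite integral_expR_sqr2.
by move=> /fine_cvg.
Unshelve. all: by end_near. Qed.

(** * Change of variables in Euler's integral *)

Lemma Gamma_gamma_kernel (R : realType) (x : R) : 1 <= x ->
  Gamma (x + 1) = x `^ (x + 1 / 2) * expR (- x) *
    \int[@lebesgue_measure R]_u gamma_kernel x u.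
Proof.
move=> x1; have x0 : 0 < x by lra.
have s0 : 0 < Num.sqrt x by rewrite sqrtr_gt0.
(* [G] extends Euler's integrand by 0 to t <= 0, so that [F], an increasing bijection of the line,
   can serve as the substitution. *)
pose G (t : R) := (Num.max 0 t) `^ x * expR (- t).
pose F (u : R) := x + Num.sqrt x * u.
have F'E : F^`()%classic = cst (Num.sqrt x).
  apply/funext => u; rewrite derive1E; apply: derive_val.
  apply: is_derive_eq.
  by rewrite /GRing.scale/= add0r mul1r mulr1.
have cG : continuous G.
  move=> t; rewrite /G; apply: cvgM; first exact: continuous_max0_powR.
  apply: (@continuous_comp _ _ _ -%R expR); first exact: continuousN.
  exact: continuous_expR.
have G0 t : 0 <= G t by rewrite mulr_ge0 ?powR_ge0 ?expR_ge0.
(* Since [F u] = x (1 + u / sqrt x), the factor x^x comes out of the power; the Jacobian sqrt x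
   supplies the remaining x^(1/2). *)
have GF u : G (F u) * Num.sqrt x =
    (x `^ (x + 1 / 2) * expR (- x)) * gamma_kernel x u.
  rewrite /G /F /gamma_kernel.
  have FE : x + Num.sqrt x * u = x * (1 + u / Num.sqrt x).
    by rewrite -{1 3}(sqr_sqrtr (ltW x0)); field; rewrite gt_eqF.
  rewrite opprD expRD FE -[in Num.max 0 _](mulr0 x) -maxr_pMr ?(ltW x0)//.
  rewrite powRM ?(ltW x0) ?le_max ?lexx//.
  rewrite powRD; last by rewrite (gt_eqF x0) implybT.
  rewrite mul1r powR12_sqrt ?(ltW x0)//.
  by ring.
rewrite /Gamma /Rintegral addrK integral_mkcond.
have -> : (\int[@lebesgue_measure R]_t
    ((fun t => (t `^ x * expR (- t))%:E) \_ `]0%R, +oo[) t =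
    \int[@lebesgue_measure R]_t (G t)%:E)%E.
  apply: eq_integral => t _; rewrite patchE /G; case: ifPn.
    by rewrite inE/= in_itv/= andbT => t0; rewrite max_r ?(ltW t0).
  rewrite notin_setE/= in_itv/= andbT => /negP; rewrite -leNgt => t0.
  by rewrite max_l// powR0 ?mul0r// gt_eqF.
rewrite (@increasing_ge0_integration_by_substitutionT _ F G)//.
- rewrite F'E.
  transitivity (fine (\int[@lebesgue_measure R]_u
      ((x `^ (x + 1 / 2) * expR (- x))%:E * (gamma_kernel x u)%:E)))%E.
    by congr fine; apply: eq_integral => u _; rewrite -EFinM -GF.
  rewrite integralZl//; last exact: integrable_gamma_kernel.
  rewrite fineM//; apply: integrable_fin_num => //.
  exact: integrable_gamma_kernel.
- by move=> u w uw; rewrite /F ltrD2l ltr_pM2l.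
- by rewrite F'E => u; exact: cvg_cst.
- by rewrite F'E; exact: is_cvg_cst.
- by rewrite F'E; exact: is_cvg_cst.
- apply/cvgrNyPle => A; near=> u.
  by rewrite /F -lerBrDl mulrC -ler_pdivlMr.
- apply/cvgryPge => A; near=> u.
  by rewrite /F -lerBlDl mulrC -ler_pdivrMr.
Unshelve. all: by end_near. Qed.

(** * Effect of a bounded shift, and the asymptotic formula *)

(** This is ln s <= s - 1 at s = 1 / (1 + v): the reciprocal turns the upper bound into a lower
    one. *)
Lemma ln1D_ge (R : realType) (v : R) : -1 < v -> v / (1 + v) <= ln (1 + v).
Proof.
move=> v1; have v0 : 0 < 1 + v by lra.
have -> : ln (1 + v) = - ln (1 + - (v / (1 + v))).
  have -> : 1 + - (v / (1 + v)) = (1 + v)^-1 by field; rewrite gt_eqF.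
  by rewrite lnV ?opprK.
rewrite lerNr; apply: le_ln1Dx.
by rewrite ltrN2 ltr_pdivrMr// mul1r; lra.
Qed.

(** Squeeze: with v = t/x, the bounds v / (1 + v) <= ln (1 + v) <= v place the expression between
    (t/2 - t^2) / (x + t) and t / (2x), both of order 1/x for bounded t. *)
Lemma cvg_shift_exponent (R : realType) (t : R -> R) (C : R) :
  (\forall x \near +oo, `|t x| <= C) ->
  (x + 1 / 2) * ln (1 + t x / x) - t x @[x --> +oo] --> (0 : R).
Proof.
move=> tC; apply/cvgr0Pnorm_le => e e0; near=> x.
have tx : `|t x| <= C by near: x.
have C0 : 0 <= C by apply: le_trans tx.
have xC : C < x by near: x; apply: nbhs_pinfty_gt; exact: num_real.
(* As x + t >= x - C, this threshold serves both sides of the squeeze. *)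
have xe : C + (C + C ^+ 2) / e <= x.
  by near: x; apply: nbhs_pinfty_ge; exact: num_real.
have {}xe : C + C ^+ 2 <= (x - C) * e by rewrite -ler_pdivrMr//; lra.
have x0 : 0 < x by lra.
move: tx; rewrite ler_norml => /andP[tl tr].
have w0 : 0 < x + t x by lra.
have vE : t x = t x / x * x by field; rewrite gt_eqF.
set v := t x / x in vE *.
have v1 : -1 < v by nra.
have lnlo := ln1D_ge R v v1.
have lnhi := le_ln1Dx v1.
rewrite ler_norml; apply/andP; split.
  have loE : (x + 1 / 2) * (v / (1 + v)) - t x =
      (t x / 2 - t x ^+ 2) / (x + t x).
    by rewrite vE; field; rewrite !gt_eqF//; nra.
  apply: (@le_trans _ _ ((x + 1 / 2) * (v / (1 + v)) - t x)).
    by rewrite loE ler_pdivlMr//; nra.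
  by rewrite lerD2r ler_wpM2l//; lra.
apply: (@le_trans _ _ ((x + 1 / 2) * v - t x)).
  by rewrite lerD2r ler_wpM2l//; lra.
have -> : (x + 1 / 2) * v - t x = v / 2 by rewrite vE; lra.
have : v <= 2 * e; last by lra.
by rewrite /v ler_pdivrMr//; nra.
Unshelve. all: by end_near. Qed.

Theorem theorem2 (R : realType) (M : R -> R -> R) (r : R -> R)
  (theta sigma : R)
  (M_pos : forall a b : R, 0 < a -> 0 < b -> 0 < M a b)
  (M_mean : is_mean `]0, +oo[ M)
  (r_lim : r x @[x --> +oo] --> (0 : R)) :
  asymp_equiv
    (fun x : R => Gamma (x + 1))
    (fun x : R => Num.sqrt (2 * pi)
       * M (x + theta) (x + sigma) `^ (x + 1 / 2)
       * expR (- M (x + theta) (x + sigma))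
       * expR (r x)).
Proof.
have sp0 : 0 < Num.sqrt (2 * pi : R) by rewrite sqrtr_gt0 mulr_gt0 ?pi_gt0.
pose C := `|theta| + `|sigma|.
pose t x := M (x + theta) (x + sigma) - x.
pose E x := (x + 1 / 2) * ln (1 + t x / x) - t x.
pose K x := \int[@lebesgue_measure R]_u gamma_kernel x u.
(* Beyond [C] both arguments of [M] are positive, so the mean property puts its value between them,
   and each is within [C] of [x]. *)
have tC : \forall x \near +oo, `|t x| <= C.
  near=> x.
  have xC : C < x by near: x; apply: nbhs_pinfty_gt; exact: num_real.
  have := ler_norm theta; have := ler_norm (- theta).
  have := ler_norm sigma; have := ler_norm (- sigma).
  rewrite !normrN => s1 s2 t1 t2.
  have := normr_ge0 theta; have := normr_ge0 sigma => s0 t0.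
  have xt : x + theta \in `]0, +oo[.
    by rewrite in_itv/= andbT; rewrite /C in xC; lra.
  have xs : x + sigma \in `]0, +oo[.
    by rewrite in_itv/= andbT; rewrite /C in xC; lra.
  have /andP[] := M_mean _ _ xt xs.
  rewrite ge_min le_max => /orP lo /orP hi.
  rewrite ler_norml /t /C; apply/andP; split; [case: lo|case: hi]; lra.
have E0 : E x @[x --> +oo] --> (0 : R) := cvg_shift_exponent R t C tC.
have L1 : Num.sqrt (2 * pi) / Num.sqrt (2 * pi) *
    (expR (- 0) * expR (- 0)) = 1 :> R.
  by rewrite divff ?gt_eqF// oppr0 expR0 !mulr1.
(* Writing M for the mean, M^(x+1/2) e^(-M) = x^(x+1/2) e^(-x) e^(E x) for large x, so the quotient
   of the two sides eventually equals this product. *)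
have : K x / Num.sqrt (2 * pi) * (expR (- E x) * expR (- r x)) @[x --> +oo] -->
    Num.sqrt (2 * pi) / Num.sqrt (2 * pi) * (expR (- 0) * expR (- 0) : R).
  apply: cvgM.
    apply: cvgM; last exact: cvg_cst.
    exact: (gamma_kernel_integral_cvg R).
  apply: cvgM.
    by apply: continuous_cvg; [exact: continuous_expR|exact: cvgN].
  by apply: continuous_cvg; [exact: continuous_expR|exact: cvgN].
rewrite L1; apply: cvg_trans; apply: near_eq_cvg; near=> x.
have tx : `|t x| <= C by near: x.
have x1 : 1 <= x by near: x; apply: nbhs_pinfty_ge; exact: num_real.
have xC : C < x by near: x; apply: nbhs_pinfty_gt; exact: num_real.
have x0 : 0 < x by lra.
move: tx; rewrite ler_norml => /andP[tl tr].
have v0 : 0 < 1 + t x / x.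
  by rewrite -(ltrD2l (-1)) addKr addr0 ltr_pdivlMr// mulN1r; lra.
rewrite Gamma_gamma_kernel//.
have ME : M (x + theta) (x + sigma) = x * (1 + t x / x).
  by rewrite /t; field; rewrite gt_eqF.
(* The factor [expR (t x)] cancels against [expR (- t x)] coming from [expR (- M ...)]. *)
have -> : M (x + theta) (x + sigma) `^ (x + 1 / 2) =
    x `^ (x + 1 / 2) * expR (E x) * expR (t x).
  rewrite ME powRM ?(ltW x0) ?(ltW v0)// -mulrA -expRD; congr (_ * _).
  by rewrite /powR gt_eqF// /E subrK.
have -> : expR (- M (x + theta) (x + sigma)) = expR (- x) * expR (- t x).
  by rewrite -expRD /t; congr expR; lra.
rewrite /K !expRN; field.
by rewrite !gt_eqF ?expR_gt0 ?powR_gt0.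
Unshelve. all: by end_near. Qed.
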